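(* Let $n\ge 3$. Fix a convex body $K\subset\mathbf{R}^2$ and let $\mathcal{H}(K)=\{t+\lambda K : t\in\mathbf{R}^2,\ \lambda\in\mathbf{R}_{>0}\}$. For any $A_0,A_1,G_1,\dots,G_n\in\mathcal{H}(K)$ with $A_0,A_1\subset \mathrm{Conv}\bigl(\bigcup_{j=1}^n G_j\bigr)$, there exist $i\in\{0,1\}$ and $j\in\{1,\dots,n\}$ such that \[ A_i\subset \mathrm{Conv}\Bigl(A_{1-i}\cup\bigcup_{k\neq j}G_k\Bigr).\]
   Context: $\mathrm{Conv}$ denotes the convex hull, and $\subset$ means not necessarily strict inclusion. A convex body is a compact convex set with nonempty interior. *)

(* Defs.v *)
From mathcomp Require Import all_boot all_order all_algebra.
From mathcomp Require Import all_classical all_reals all_analysis.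

Set Implicit Arguments.
Unset Strict Implicit.
Unset Printing Implicit Defensive.

Import Order.TTheory GRing.Theory Num.Theory.
Import numFieldNormedType.Exports.

Local Open Scope classical_set_scope.
Local Open Scope ring_scope.

Definition conv_hull (R : realType) (E : lmodType R) (A : set E) : set E :=
  smallest (@convex_set R E) A.

Definition convex_body (R : realType) (E : normedModType R) (K : set E) :=
  [/\ @convex_set R E K, compact K & interior K !=set0].

Definition homothets (R : realType) (E : lmodType R) (K : set E) :
    set (set E) :=
  [set A | exists t : E, exists2 lambda : R, 0 < lambda &
             A = [set t + lambda *: x | x in K]].

(* Main.v *)
Require Import Defs.
From mathcomp Require Import all_boot all_order all_algebra.
From mathcomp Require Import all_classical all_reals all_analysis.
From mathcomp Require Import ring lra.

Import Order.TTheory GRing.Theory Num.Theory.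
Import numFieldNormedType.Exports.

Local Open Scope classical_set_scope.
Local Open Scope ring_scope.

(** Evaluate a homothet [a + l K] in a direction [u] at a point [c] of [K] where
    the linear form [u] is maximal on [K]: the support function of the homothet
    at [u] is [dot u a + l * dot u c].  This is a linear form with coefficients
    [(a, l)], evaluated at the vector [(u, dot u c)] of R^3.  Thus homothets
    become linear forms on R^3 and directions become vectors of R^3, which lie
    on the graph of the support function of [K].  That graph bounds a convex
    cone: each contact point [c] gives the form [(u, s) |-> s - dot u c], which
    is nonnegative on all these vectors and vanishes at its own vector.

    Suppose that the conclusion fails for all [i] and [j].  Since the hulls in
    question are compact, strict separation applies and gives, for every [i]
    and [j], a direction where [A i] exceeds [A (~~ i)] and all [G k] with
    [k <> j]; as [A i] lies in the hull of all the [G k], [G j] must reach at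
    least as far as [A i] there ([separating_contact]).  Keep three indices [j],
    and write [p j] and [x j] for the vectors obtained with [i = false] and
    [i = true].  The form [psi] (the difference of [A false] and [A true]) is
    positive at each [p j] and negative at each [x j].  The form [phi j] (the
    difference of [A false] and [G j]) is positive at [p k] for [k <> j],
    nonpositive at [p j] and negative at [x j].

    Geometrically, with the origin inside [K], cut the cone by a plane to get
    six points on a closed convex curve, with the [p j] and the [x j] on either
    side of a line.  The point [p i] in the middle of the three [p j] is joined
    to every point across the line by a chord that crosses the chord of the
    other two.  Use the chord from [p i] to [x i]: [phi i] is nonpositive at
    both of its ends, but positive at both ends of the chord that it crosses.
    The argument below is this one in coordinates ([no_six_points]): the [p j]
    form a basis, in which every [x j] has exactly one negative coordinate
    ([exactly_one_neg]), whose index [i] is the same for all [x j]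
    ([neg_coord_unique]); the signs of [phi i] are then incompatible with the
    expansion of [x i]. *)

(** * Convex hulls and compactness *)

Lemma convex_setP {R : realType} {E : lmodType R} (A : set E) :
  @convex_set R E A <-> forall (t : R) (x y : E), 0 <= t <= 1 -> A x -> A y ->
    A (t *: x + (1 - t) *: y).
Proof.
split=> [cA t x y /andP[t0 t1] Ax Ay|cA x y t /set_mem Ax /set_mem Ay].
  by apply/set_mem/(cA x y (Itv01 t0 t1)); apply/mem_set.
by apply/mem_set/cA => //; apply/andP; split.
Qed.

(** Combinations with weights of arbitrary sum [s + t], zero included, so that
    normalising the weights of a two-part combination below never divides by
    zero. *)
Lemma convex_weighted {R : realType} {E : lmodType R} (A : set E) (s t : R)
    (x y : E) : @convex_set R E A -> 0 <= s -> 0 <= t -> A x -> A y ->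
  exists2 z, A z & s *: x + t *: y = (s + t) *: z.
Proof.
move=> /convex_setP cA s0 t0 Ax Ay.
have [st0|st_neq0] := eqVneq (s + t) 0.
  exists x => //; move/eqP: st0; rewrite paddr_eq0 // => /andP[/eqP-> /eqP->].
  by rewrite addr0 !scale0r addr0.
have st_gt0 : 0 < s + t by rewrite lt_neqAle eq_sym st_neq0 addr_ge0.
exists (s / (s + t) *: x + (1 - s / (s + t)) *: y).
  apply: cA => //.
  by rewrite divr_ge0 ?(ltW st_gt0) //= ler_pdivrMr ?mul1r ?lerDl.
by rewrite scalerDr !scalerA; congr (_ *: _ + _ *: _); field.
Qed.

Lemma conv_hull_convex {R : realType} {E : lmodType R} (S : set E) :
  @convex_set R E (conv_hull S).
Proof.
apply/convex_setP => t x y t01 Sx Sy A AP.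
by apply: (convex_setP A).1 => //; [exact: AP.1|exact: Sx|exact: Sy].
Qed.

(** The right-hand side is the image of a product of three sets, hence compact
    when [A] and [B] are; it is convex because the weights put on [A] and on [B]
    can be merged separately. *)
Lemma conv_hull_join {R : realType} {E : lmodType R} (A B : set E) :
  @convex_set R E A -> @convex_set R E B -> A !=set0 -> B !=set0 ->
  conv_hull (A `|` B) =
  [set p.1 *: p.2.1 + (1 - p.1) *: p.2.2 |
     p in `[(0 : R), 1] `*` (A `*` B)].
Proof.
move=> cA cB [a Aa] [b Bb].
apply/seteqP; split=> [|_ [[t [x y]] + <-]]; last first.
  move=> /= [t01 [Ax By]].
  have /convex_setP hull_convex := conv_hull_convex (A `|` B).
  apply: hull_convex => //.
  - by apply: sub_gen_smallest; left.
  - by apply: sub_gen_smallest; right.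
apply: smallest_sub => [|x [Ax|Bx]].
- apply/convex_setP => s p q /andP[s0 s1] [[t [x y]] [/= t01 [Ax By]] <-{p}].
  move=> [[t' [x' y']] [/= t'01 [Ax' By']] <-{q}].
  move: t01 t'01; rewrite /= !in_itv/= => /andP[t0 t1] /andP[t'0 t'1].
  have s'0 : 0 <= 1 - s by lra.
  have [z Az zE] := convex_weighted _ _ _ _ _ cA
    (mulr_ge0 s0 t0) (mulr_ge0 s'0 t'0) Ax Ax'.
  have [w Bw wE] := convex_weighted _ (s * (1 - t)) ((1 - s) * (1 - t'))
    _ _ cB ltac:(nra) ltac:(nra) By By'.
  exists (s * t + (1 - s) * t', (z, w)); rewrite /= ?in_itv/=.
    split => //; apply/andP; split; nra.
  rewrite -zE; have -> : 1 - (s * t + (1 - s) * t') =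
    s * (1 - t) + (1 - s) * (1 - t') by ring.
  by rewrite -wE !scalerDr !scalerA addrACA.
- exists (1, (x, b)); rewrite /= ?in_itv/= ?lexx ?ler01 //.
  by rewrite subrr scale1r scale0r addr0.
- exists (0, (a, x)); rewrite /= ?in_itv/= ?lexx ?ler01 //.
  by rewrite subr0 scale1r scale0r add0r.
Qed.

Lemma compact_conv_hullU {R : realType} {E : normedModType R} (A B : set E) :
  @convex_set R E A -> @convex_set R E B -> compact A -> compact B ->
  compact (conv_hull (A `|` B)).
Proof.
move=> cA cB kA kB.
have [->|A0] := eqVneq A set0; first by rewrite set0U /conv_hull smallest_id.
have [->|B0] := eqVneq B set0; first by rewrite setU0 /conv_hull smallest_id.
rewrite conv_hull_join //; try exact/set0P.
apply: continuous_compact; last first.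
  by apply: compact_setX; [exact: segment_compact|exact: compact_setX].
apply: continuous_subspaceT => p.
apply: cvgD; apply: cvgZ.
- exact: cvg_fst.
- apply: (@cvg_comp _ _ _ snd fst); [exact: cvg_snd|exact: cvg_fst].
- apply: cvgB; [exact: cvg_cst|exact: cvg_fst].
- apply: (@cvg_comp _ _ _ snd snd); [exact: cvg_snd|exact: cvg_snd].
Qed.

Lemma conv_hullUr {R : realType} {E : lmodType R} (A B : set E) :
  conv_hull (A `|` conv_hull B) = conv_hull (A `|` B).
Proof.
apply/seteqP; split.
  apply: smallest_sub; first exact: conv_hull_convex.
  move=> x [Ax|]; first by apply: sub_gen_smallest; left.
  by apply: sub_smallest2r => [|y By]; [exact: conv_hull_convex|right].
apply: sub_smallest2r; first exact: conv_hull_convex.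
by move=> x [Ax|Bx]; [left|right; apply: sub_gen_smallest].
Qed.

Lemma compact_conv_hull_bigcup {R : realType} {E : normedModType R}
    (I : eqType) (s : seq I) (F : I -> set E) :
  (forall i, @convex_set R E (F i)) -> (forall i, compact (F i)) ->
  compact (conv_hull (\bigcup_(i in [set` s]) F i)).
Proof.
move=> cF kF; elim: s => [|i s IHs].
  rewrite set_nil bigcup_set0 /conv_hull smallest_id; first exact: compact0.
  by move=> x y t; rewrite in_set0.
have -> : [set` i :: s] = i |` [set` s].
  apply/seteqP; split=> x /=; rewrite inE; first by case/predU1P; [left|right].
  by case=> [->|->]; rewrite ?eqxx ?orbT.
rewrite bigcup_setU1 -conv_hullUr.
by apply: compact_conv_hullU => //; exact: conv_hull_convex.
Qed.

(** * Strict separation of a point from a compact convex set *)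

Definition dot {R : realType} {n} (u x : 'rV[R]_n) : R := (u *m x^T) 0 0.

Lemma continuous_dot {R : realType} {T : topologicalType} {n}
    {f g : T -> 'rV[R]_n.+1} :
  continuous f -> continuous g -> continuous (fun t => dot (f t) (g t)).
Proof.
move=> cf cg.
have -> : (fun t => dot (f t) (g t)) = \sum_i (fun t => f t 0 i * g t 0 i).
  apply/funext => t; rewrite /dot mxE fct_sumE.
  by apply: eq_bigr => i _; rewrite mxE.
elim/big_ind: _ => [||i _ t]; first exact: cst_continuous.
  by move=> F G cF cG t; apply: cvgD; [exact: cF|exact: cG].
apply: cvgM.
- apply: (@cvg_comp _ _ _ f (fun v : 'rV_n.+1 => v 0 i)); first exact: cf.
  exact: coord_continuous.
- apply: (@cvg_comp _ _ _ g (fun v : 'rV_n.+1 => v 0 i)); first exact: cg.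
  exact: coord_continuous.
Qed.

Lemma dot_conv {R : realType} {n} (u x y : 'rV[R]_n) (t : R) :
  dot u (t *: x + (1 - t) *: y) = t * dot u x + (1 - t) * dot u y.
Proof. by rewrite /dot linearD !linearZ /= mulmxDr -!scalemxAr !mxE. Qed.

Lemma dotBl {R : realType} {n} (u v w : 'rV[R]_n) :
  dot (u - v) w = dot u w - dot v w.
Proof. by rewrite /dot mulmxBl !mxE. Qed.

Lemma dotZl {R : realType} {n} (t : R) (u w : 'rV[R]_n) :
  dot (t *: u) w = t * dot u w.
Proof. by rewrite /dot -scalemxAl mxE. Qed.

Lemma dotC {R : realType} {n} (u v : 'rV[R]_n) : dot u v = dot v u.
Proof. by rewrite /dot !mxE; apply: eq_bigr => i _; rewrite !mxE mulrC. Qed.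

Lemma dot_sqr_subZ {R : realType} {n} (t : R) (u w : 'rV[R]_n) :
  dot (u - t *: w) (u - t *: w) =
  dot u u - 2 * t * dot u w + t ^+ 2 * dot w w.
Proof.
rewrite dotBl dotZl !(dotC _ (u - _)) !dotBl !dotZl (dotC w u); ring.
Qed.

Lemma dot_sqr_ge0 {R : realType} {n} (u : 'rV[R]_n) : 0 <= dot u u.
Proof. by rewrite /dot mxE sumr_ge0 // => i _; rewrite mxE -expr2 sqr_ge0. Qed.

Lemma dot_sqr_eq0 {R : realType} {n} (u : 'rV[R]_n) : dot u u = 0 -> u = 0.
Proof.
rewrite /dot mxE => /eqP; rewrite psumr_eq0 => [/allP u0|i _]; last first.
  by rewrite mxE -expr2 sqr_ge0.
apply/rowP => i; have := u0 i (mem_index_enum _).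
by rewrite mxE mulf_eq0 orbb mxE => /eqP.
Qed.

(** The separating direction is [x - z], with [z] a point of [C] nearest to [x]
    for the Euclidean distance: moving from [z] towards another point [y] of [C]
    cannot decrease the distance to [x], which forces
    [dot (x - z) (y - z) <= 0]. *)
Lemma strict_separation {R : realType} {n} (C : set 'rV[R]_n.+1)
    (x : 'rV[R]_n.+1) :
  @convex_set R 'rV[R]_n.+1 C -> compact C -> ~ C x ->
  exists u, forall y, C y -> dot u y < dot u x.
Proof.
move=> /convex_setP cC kC nCx.
have [->|/set0P C0] := eqVneq C set0; first by exists 0.
have cont_sqdist : continuous (fun y : 'rV_n.+1 => dot (x - y) (x - y)).
  have cont_sub : continuous (fun y : 'rV[R]_n.+1 => x - y).
    move=> y; apply: (@continuousB _ _ _ (cst x) id); last exact: cvg_id.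
    exact: cst_continuous.
  exact: (continuous_dot cont_sub cont_sub).
have [z /set_mem Cz z_min] := compact_EVT_min C0 kC
  (continuous_subspaceT cont_sqdist).
exists (x - z) => y Cy; set u := x - z; set w := y - z.
(* compare [z] with the point at parameter [t] on the segment from [z] to [y] *)
have zy_sqdist t : 0 <= t <= 1 ->
    dot u u <= dot u u - 2 * t * dot u w + t ^+ 2 * dot w w.
  move=> t01; have /mem_set/z_min := cC t y z t01 Cy Cz.
  have -> : x - (t *: y + (1 - t) *: z) = u - t *: w.
    by apply/rowP => i; rewrite !mxE; ring.
  by rewrite -/u dot_sqr_subZ.
have w_ge0 := dot_sqr_ge0 w.
have u_gt0 : 0 < dot u u.
  rewrite lt_neqAle dot_sqr_ge0 andbT eq_sym; apply/eqP => /dot_sqr_eq0.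
  by move=> /subr0_eq xz; apply: nCx; rewrite xz.
have uw_le0 : dot u w <= 0.
  rewrite leNgt; apply/negP => uw_gt0.
  have s_gt0 : 0 < dot u w + dot w w by rewrite ltr_pwDl.
  (* small enough for the linear term to dominate, yet at most 1 *)
  pose t := dot u w / (dot u w + dot w w).
  have t_gt0 : 0 < t by rewrite divr_gt0.
  have t_le1 : t <= 1 by rewrite ler_pdivrMr // mul1r lerDl.
  have tE : t * (dot u w + dot w w) = dot u w by rewrite divfK ?gt_eqF.
  have := zy_sqdist t; rewrite (ltW t_gt0) t_le1 => /(_ isT).
  move: t_gt0 t_le1 tE w_ge0 uw_gt0; move: t (dot u w) (dot w w) (dot u u).
  move=> {}t a b c; nra.
suff : dot u u - dot u w = dot u x - dot u y by lra.
by rewrite !(dotC u) -!dotBl /w opprB addrA subrK.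
Qed.

(** * Sign patterns of six vectors in dimension three *)

Lemma ord3_third (i j : 'I_3) : i != j ->
  exists k, [/\ k != i, k != j, forall l, l \in [:: i; j; k] &
    forall (V : nmodType) (F : 'I_3 -> V), \sum_l F l = F i + (F j + F k)].
Proof.
move=> neq_ij; have [k kC] : {k | k \in ~: [set i; j]}.
  by apply/sigW/card_gt0P; rewrite cardsCs finset.setCK cards2 neq_ij card_ord.
move: kC; rewrite !inE negb_or => /andP[neq_ki neq_kj].
have uniq_ijk : uniq [:: i; j; k].
  by rewrite /= !inE negb_or neq_ij eq_sym neq_ki eq_sym neq_kj.
have all_ijk l : l \in [:: i; j; k].
  have /subset_cardP all_in : #|[:: i; j; k]| = #|'I_3|.
    by rewrite (card_uniqP uniq_ijk) card_ord.
  by rewrite (all_in _ l) //; apply/subset_predT.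
exists k; split=> // V F.
transitivity (\sum_(l <- [:: i; j; k]) F l); last first.
  by rewrite !big_cons big_nil addr0.
by rewrite (big_uniq _ uniq_ijk); apply: eq_bigl => l; rewrite all_ijk.
Qed.

(** Pairing [l] with column [j] of [A] gives a sum of nonnegative terms, so each
    of them vanishes and [l] is supported at [j]; then [w] kills that
    coordinate as well. *)
Lemma one_neg_coord_eq0 {R : realFieldType} (w : 'cV[R]_3) (A : 'M[R]_3)
    (l : 'rV[R]_3) (j : 'I_3) :
  (forall k, 0 < w k 0) ->
  A j j <= 0 -> (forall k, k != j -> 0 < A k j) ->
  l *m w = 0 -> l *m A = 0 ->
  l 0 j <= 0 -> (forall k, k != j -> 0 <= l 0 k) -> l = 0.
Proof.
move=> w_gt0 Aj_le0 A_gt0 lw0 lA0 lj_le0 l_ge0.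
have lk0 k : k != j -> l 0 k = 0.
  move=> kj; have /eqP := congr1 (fun M : 'rV_3 => M 0 j) lA0.
  rewrite !mxE psumr_eq0; last first.
    move=> i _; have [->|ij] := eqVneq i j; first by rewrite mulr_le0.
    by rewrite mulr_ge0 ?l_ge0 // ltW ?A_gt0.
  move=> /allP/(_ k (mem_index_enum _))/=.
  by rewrite mulf_eq0 (gt_eqF (A_gt0 k kj)) orbF => /eqP.
apply/rowP => k; rewrite mxE; have [->|/lk0 //] := eqVneq k j.
have /eqP := congr1 (fun M : 'M[R]_1 => M 0 0) lw0.
rewrite !mxE (bigD1 j) //= big1 => [|i /lk0->]; last by rewrite mul0r.
by rewrite addr0 mulf_eq0 (gt_eqF (w_gt0 j)) orbF => /eqP.
Qed.

(** In a linear relation [l] between the rows of [P], [psi] forbids that all the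
    coefficients have the same sign.  Of three coefficients, up to a change of
    sign, one is nonpositive and the other two are nonnegative, which
    [one_neg_coord_eq0] excludes: no row is between the other two. *)
Lemma unitmx_of_signs {R : realFieldType} (P : 'M[R]_3)
    (psi : 'cV[R]_3) (Phi : 'M[R]_3) :
  (forall j, 0 < (P *m psi) j 0) ->
  (forall j, (P *m Phi) j j <= 0) ->
  (forall j k, k != j -> 0 < (P *m Phi) k j) ->
  P \in unitmx.
Proof.
move=> psi_gt0 Phi_diag Phi_gt0.
rewrite -row_free_unit -kermx_eq0; apply/eqP/row_matrixP => r; rewrite row0.
have : row r (kermx P) *m P = 0 by apply/sub_kermxP; rewrite row_sub.
move: (row r _) => l lP0.
have eq0 (m : 'rV_3) j : m *m P = 0 -> m 0 j <= 0 ->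
    (forall k, k != j -> 0 <= m 0 k) -> m = 0.
  move=> mP0; apply: (one_neg_coord_eq0 _ _ _ _ psi_gt0 (Phi_diag j)).
  - exact: Phi_gt0.
  - by rewrite mulmxA mP0 mul0mx.
  - by rewrite mulmxA mP0 mul0mx.
have lw0 : \sum_j l 0 j * (P *m psi) j 0 = 0.
  have := congr1 (fun M : 'M[R]_1 => M 0 0) (mulmxA l P psi).
  by rewrite lP0 mul0mx !mxE.
have [/forallP l_gt0|] := boolP [forall i, 0 < l 0 i].
  suff /gt_eqF/eqP : 0 < \sum_j l 0 j * (P *m psi) j 0 by [].
  rewrite (bigD1 ord0) //= ltr_pwDl ?mulr_gt0 // sumr_ge0 // => j _.
  by rewrite mulr_ge0 // ltW.
rewrite negb_forall => /existsP[i]; rewrite -leNgt => li_le0.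
have [/forallP l_ge0|] := boolP [forall k, (k != i) ==> (0 <= l 0 k)].
  by apply: (eq0 l i) => // k; apply/implyP.
rewrite negb_forall => /existsP[j].
rewrite negb_imply -ltNge => /andP[ji lj_lt0].
have [k [ki kj all_in sum3]] := ord3_third _ _ ji.
apply/eqP; rewrite -oppr_eq0; apply/eqP.
have lk_ge0 : 0 <= l 0 k.
  have := lw0; rewrite sum3.
  have := psi_gt0 i; have := psi_gt0 j; have := psi_gt0 k; nra.
apply: (eq0 _ k); rewrite ?mulNmx ?lP0 ?oppr0 ?mxE ?oppr_le0 // => m.
by have := all_in m; rewrite !inE mxE oppr_ge0 => /or3P[]/eqP-> //;
  rewrite ?eqxx // ltW.
Qed.

Lemma third_pos {R : realFieldType} (B : 'M[R]_3) (i j k : 'I_3) :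
  (forall l, l \in [:: i; j; k]) -> B k k = 0 ->
  (forall l, 0 <= B l k) -> (exists l, 0 < B l k) -> 0 < B i k + B j k.
Proof.
move=> all_in Bk Bge0 [l Bl]; have := all_in l; rewrite !inE => /or3P[]/eqP le.
- by rewrite -le ltr_pwDl.
- by rewrite -le ltr_wpDl.
- by move: Bl; rewrite le Bk ltxx.
Qed.

(** Here [l] holds the coordinates of a vector in a basis [p], with [w] and the
    columns of [B] the values on [p] of a form and of three supporting forms.
    If two coordinates [i] and [j] were negative, then a multiple of [p k], for
    the third index [k], would be the sum of that vector and of positive
    multiples of [p i] and [p j]; the form that supports at [p k] would then
    vanish on the whole basis. *)
Lemma exactly_one_neg {R : realFieldType} (w : 'cV[R]_3) (B : 'M[R]_3)
    (l : 'rV[R]_3) :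
  (forall j, 0 < w j 0) -> (l *m w) 0 0 < 0 ->
  (forall k, B k k = 0) -> (forall j k, 0 <= B j k) ->
  (forall k, exists j, 0 < B j k) -> (forall k, 0 <= (l *m B) 0 k) ->
  exists2 i, l 0 i < 0 & forall j, j != i -> 0 <= l 0 j.
Proof.
move=> w_gt0 lw_lt0 Bdiag B_ge0 B_neq0 lB_ge0.
have [/forallP l_ge0|] := boolP [forall i, 0 <= l 0 i].
  move: lw_lt0; rewrite mxE ltNge sumr_ge0 // => j _.
  by rewrite mulr_ge0 // ltW.
rewrite negb_forall => /existsP[i]; rewrite -ltNge => li_lt0.
exists i => // j ji; rewrite leNgt; apply/negP => lj_lt0.
have [k [_ _ all_in sum3]] := ord3_third _ _ ji.
have := third_pos _ _ _ _ all_in (Bdiag k) (B_ge0^~ k) (B_neq0 k).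
have := lB_ge0 k; rewrite mxE sum3 Bdiag mulr0 addr0.
have := B_ge0 i k; have := B_ge0 j k.
move: (B j k) (B i k) => b b' b_ge0 b'_ge0 lb_ge0 bb'_gt0.
have : l 0 j * b <= 0 by nra.
have : l 0 i * b' <= 0 by nra.
have : 0 < b -> l 0 j * b < 0 by move=> ?; nra.
have : 0 < b' -> l 0 i * b' < 0 by move=> ?; nra.
have [b_le0|b_gt0] := lerP b 0; last by move=> _ /(_ isT); lra.
have b'_gt0 : 0 < b' by lra.
by move=> /(_ b'_gt0) + _; lra.
Qed.

(** If the negative coordinates [i] of [l] and [j] of [m] differ, eliminate one
    of these two coordinates from [l] and [m] by the nonnegative combination
    [m i * l - l i * m], which has coordinate
    [D := l j * m i - l i * m j] at [j].  When [D >= 0] the combination has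
    nonnegative coordinates, against its sign under [w].  When [D < 0], the
    form supporting at the third basis vector vanishes at [j]; by the symmetric
    elimination it vanishes at [i], hence on the whole basis. *)
Lemma neg_coord_unique {R : realFieldType} (w : 'cV[R]_3) (B : 'M[R]_3)
    (l m : 'rV[R]_3) (i j : 'I_3) :
  (forall j, 0 < w j 0) -> (l *m w) 0 0 < 0 -> (m *m w) 0 0 < 0 ->
  (forall k, B k k = 0) -> (forall j k, 0 <= B j k) ->
  (forall k, exists j, 0 < B j k) ->
  (forall k, 0 <= (l *m B) 0 k) -> (forall k, 0 <= (m *m B) 0 k) ->
  l 0 i < 0 -> (forall k, k != i -> 0 <= l 0 k) ->
  m 0 j < 0 -> (forall k, k != j -> 0 <= m 0 k) -> i = j.
Proof.
move=> w_gt0 lw_lt0 mw_lt0 Bdiag B_ge0 B_neq0 lB_ge0 mB_ge0.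
move=> li_lt0 l_ge0 mj_lt0 m_ge0; apply/eqP/negPn/negP => ij.
have [k [ki kj all_in sum3]] := ord3_third _ _ ij.
have := third_pos _ _ _ _ all_in (Bdiag k) (B_ge0^~ k) (B_neq0 k).
have := lB_ge0 k; have := mB_ge0 k; have := B_ge0 i k; have := B_ge0 j k.
have := lw_lt0; have := mw_lt0; rewrite !mxE !sum3 Bdiag !mulr0 !addr0.
have := w_gt0 i; have := w_gt0 j; have := w_gt0 k.
have := l_ge0 k ki; have := m_ge0 k kj.
have := m_ge0 i ij; have := l_ge0 j; rewrite eq_sym => /(_ ij).
move: li_lt0 mj_lt0.
move: (l 0 i) (l 0 j) (l 0 k) (m 0 i) (m 0 j) (m 0 k) (w i 0) (w j 0) (w k 0).
move: (B i k) (B j k) => b1 b2 li lj lk mi mj mk wi wj wk.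
move=> li0 mj0 lj0 mi0 mk0 lk0 wk0 wj0 wi0 mw lw b20 b10 mB lB b12.
have [D|D] := leP 0 (lj * mi - li * mj).
  (* [mi * l - li * m]: its coordinate at [k], then its value under [w] *)
  have : 0 <= lk * mi - li * mk by nra.
  have : mi * (li * wi + (lj * wj + lk * wk)) -
    li * (mi * wi + (mj * wj + mk * wk)) < 0 by nra.
  nra.
(* supporting form at the combinations eliminating [i], respectively [j] *)
have : 0 <= (lj * mi - li * mj) * b2 by nra.
have : 0 <= (lj * mi - li * mj) * b1 by nra.
nra.
Qed.

(** The rows of [P] and [X] are the six vectors, the columns of [Phi] and [Chi]
    are forms.  The row [L] of coordinates of [x i] in the basis [P] is negative
    at the common index [i] only, so every term of its pairing with [phi i] is
    nonnegative, although [phi i] is negative at [x i]. *)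
Lemma no_six_points {R : realFieldType} (P X Phi Chi : 'M[R]_3)
    (psi : 'cV[R]_3) :
  (forall j, 0 < (P *m psi) j 0) -> (forall j, (X *m psi) j 0 < 0) ->
  (forall j k, k != j -> 0 < (P *m Phi) k j) ->
  (forall j, (P *m Phi) j j <= 0) -> (forall j, (X *m Phi) j j < 0) ->
  (forall j k, 0 <= (P *m Chi) j k) -> (forall j, (P *m Chi) j j = 0) ->
  (forall j k, 0 <= (X *m Chi) j k) -> (forall j, col j Chi != 0) -> False.
Proof.
move=> Ppsi Xpsi PPhi PPhi_diag XPhi PChi PChi_diag XChi Chi_neq0.
have Punit := unitmx_of_signs _ _ _ Ppsi PPhi_diag PPhi.
pose L := X *m invmx P.
have XE : X = L *m P by rewrite mulmxKV.
have Chi_pos k : exists j, 0 < (P *m Chi) j k.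
  apply/existsP; have [//|] := boolP [exists j, 0 < (P *m Chi) j k].
  rewrite negb_exists => /forallP PChi_le0.
  have /eqP[] := Chi_neq0 k; rewrite -[col k Chi](mulKmx Punit).
  rewrite (_ : P *m _ = 0) ?mulmx0 //; apply/colP => j.
  rewrite colE mulmxA -colE mxE [RHS]mxE.
  by apply/le_anti; rewrite PChi andbT leNgt.
have Lpsi j : (row j L *m (P *m psi)) 0 0 < 0.
  by rewrite mulmxA -row_mul -XE -row_mul mxE.
have LChi j k : 0 <= (row j L *m (P *m Chi)) 0 k.
  by rewrite mulmxA -row_mul -XE -row_mul mxE.
have neg_coord j := exactly_one_neg _ _ _ Ppsi (Lpsi j) PChi_diag PChi
  Chi_pos (LChi j).
have {neg_coord} [i Lneg] : exists i, forall j,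
    row j L 0 i < 0 /\ (forall k, k != i -> 0 <= row j L 0 k).
  have [i li l_ge0] := neg_coord ord0; exists i => j.
  have [i' li' l'_ge0] := neg_coord j.
  suff -> : i = i' by [].
  exact: (neg_coord_unique _ _ _ _ _ _ Ppsi (Lpsi ord0) (Lpsi j) PChi_diag
    PChi Chi_pos (LChi ord0) (LChi j) li l_ge0 li' l'_ge0).
have [Lii L_ge0] := Lneg i.
have := XPhi i; rewrite XE -mulmxA mxE ltNge sumr_ge0 // => k _.
have [->|ki] := eqVneq k i.
  by rewrite mulr_le0 //; have := ltW Lii; rewrite mxE.
by rewrite mulr_ge0 // ?(ltW (PPhi _ _ ki)) //; have := L_ge0 k ki; rewrite mxE.
Qed.

Lemma no_six_vectors {R : realFieldType} (p x : 'I_3 -> 'rV[R]_3)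
    (phi chi : 'I_3 -> 'cV[R]_3) (psi : 'cV[R]_3) :
  (forall j, 0 < (p j *m psi) 0 0) -> (forall j, (x j *m psi) 0 0 < 0) ->
  (forall j k, k != j -> 0 < (p k *m phi j) 0 0) ->
  (forall j, (p j *m phi j) 0 0 <= 0) -> (forall j, (x j *m phi j) 0 0 < 0) ->
  (forall j k, 0 <= (p k *m chi j) 0 0) -> (forall j, (p j *m chi j) 0 0 = 0) ->
  (forall j k, 0 <= (x k *m chi j) 0 0) -> (forall j, chi j != 0) -> False.
Proof.
have entry (v : 'I_3 -> 'rV[R]_3) m (f : 'I_m -> 'cV[R]_3) j k :
    ((\matrix_i v i) *m (\matrix_(i, l) f l i 0)) j k = (v j *m f k) 0 0.
  by rewrite !mxE; apply: eq_bigr => i _; rewrite !mxE.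
have col_chi j : col j (\matrix_(i, l) chi l i 0 : 'M[R]_3) = chi j.
  by apply/colP => i; rewrite !mxE.
move=> p_psi x_psi p_phi p_phi_diag x_phi p_chi p_chi_diag x_chi chi_neq0.
by apply: (@no_six_points _ (\matrix_i p i) (\matrix_i x i)
  (\matrix_(i, l) phi l i 0) (\matrix_(i, l) chi l i 0)
  (\matrix_(i, l) psi i 0)) => *; rewrite ?entry ?col_chi; auto.
Qed.

(** * Homothets as linear forms on contact vectors *)

Definition homothet {R : realType} {n} (K : set 'rV[R]_n) (a : 'rV[R]_n)
    (l : R) : set 'rV[R]_n := [set a + l *: x | x in K].

Lemma dotDZ {R : realType} {n} (u a c : 'rV[R]_n) (l : R) :
  dot u (a + l *: c) = dot u a + l * dot u c.
Proof. by rewrite /dot linearD linearZ /= mulmxDr -scalemxAr !mxE. Qed.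

Lemma convex_homothet {R : realType} {n} (K : set 'rV[R]_n) a l :
  @convex_set R 'rV[R]_n K -> @convex_set R 'rV[R]_n (homothet K a l).
Proof.
move=> /convex_setP cK; apply/convex_setP => t _ _ t01 [x Kx <-] [y Ky <-].
exists (t *: x + (1 - t) *: y); first exact: cK.
by apply/rowP => i; rewrite !mxE; ring.
Qed.

Lemma compact_homothet {R : realType} {n} (K : set 'rV[R]_n.+1) a l :
  compact K -> compact (homothet K a l).
Proof.
apply: continuous_compact; apply: continuous_subspaceT => x.
apply: (@continuousD _ _ _ (cst a) ( *:%R l)); first exact: cst_continuous.
exact: scaler_continuous.
Qed.

(** A direction separating a point of the homothet [a + al K] from the hull of
    the others separates, a fortiori, its point over the maximiser [c] of the
    direction on [K].  That point lies in the hull of all the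
    [g k + ga k K], so one of them must reach the same height, and [j] is the
    only candidate left. *)
Lemma separating_contact {R : realType} {n} {I : finType} {K : set 'rV[R]_n.+1}
    {a b : 'rV[R]_n.+1} {g : I -> 'rV[R]_n.+1} {al be : R} {ga : I -> R}
    {j : I} :
  @convex_set R 'rV[R]_n.+1 K -> compact K ->
  0 < al -> (forall k, 0 < ga k) ->
  homothet K a al `<=` conv_hull (\bigcup_k homothet K (g k) (ga k)) ->
  ~ homothet K a al `<=` conv_hull (homothet K b be `|`
      \bigcup_(k in [set k | k != j]) homothet K (g k) (ga k)) ->
  exists uc : 'rV[R]_n.+1 * 'rV[R]_n.+1, let: (u, c) := uc in
    [/\ K c /\ forall y, K y -> dot u y <= dot u c,
        dot u (b + be *: c) < dot u (a + al *: c),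
        forall k, k != j -> dot u (g k + ga k *: c) < dot u (a + al *: c) &
        dot u (a + al *: c) <= dot u (g j + ga j *: c)].
Proof.
move=> cK kK al_gt0 ga_gt0 a_sub /existsNP[x0 /not_implyP[[x Kx <-{x0}]]].
set S := _ `|` _ => nhull.
have kS : compact (conv_hull S).
  have -> : S = homothet K b be `|`
      \bigcup_(k in [set` enum (predC1 j)]) homothet K (g k) (ga k).
    congr (_ `|` bigcup _ _); apply/seteqP; split=> k /=; rewrite mem_enum //.
  rewrite -conv_hullUr; apply: compact_conv_hullU.
  - exact: convex_homothet.
  - exact: conv_hull_convex.
  - exact: compact_homothet.
  - apply: compact_conv_hull_bigcup => k; first exact: convex_homothet.
    exact: compact_homothet.
have [u u_sep] := strict_separation _ _ (conv_hull_convex S) kS nhull.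
have dot_cont : {within K, continuous (dot u)}.
  apply: continuous_subspaceT; apply: (@continuous_dot _ _ _ (cst u) id).
    exact: cst_continuous.
  by move=> y; exact: cvg_id.
have [c /set_mem Kc c_max] := compact_EVT_max (ex_intro _ x Kx) kK dot_cont.
have c_maxK y : K y -> dot u y <= dot u c by move=> /mem_set/c_max.
have x_le : dot u (a + al *: x) <= dot u (a + al *: c).
  by rewrite !dotDZ lerD2l ler_pM2l // c_maxK.
have sep y : S y -> dot u y < dot u (a + al *: c).
  by move=> Sy; apply: lt_le_trans x_le; apply: u_sep; apply: sub_gen_smallest.
have sep_k k : k != j -> dot u (g k + ga k *: c) < dot u (a + al *: c).
  by move=> kj; apply: sep; right; exists k => //; exists c.
exists (u, c); split => //; first by apply: sep; left; exists c.
rewrite leNgt; apply/negP => gj_lt.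
(* otherwise all the homothets lie in one open half-plane, which is convex *)
suff : dot u (a + al *: c) < dot u (a + al *: c) by rewrite ltxx.
have c_hull : conv_hull (\bigcup_k homothet K (g k) (ga k)) (a + al *: c).
  by apply: a_sub; exists c.
apply: (c_hull [set y | dot u y < dot u (a + al *: c)]); split.
  apply/convex_setP => t y z /andP[t0 t1] /= y_lt z_lt; rewrite dot_conv.
  have [->|t_neq0] := eqVneq t 0; first by rewrite mul0r add0r subr0 mul1r.
  have t_gt0 : 0 < t by rewrite lt_neqAle eq_sym t_neq0.
  nra.
move=> _ [k _ [y Ky <-]] /=.
apply: (@le_lt_trans _ _ (dot u (g k + ga k *: c))).
  by rewrite !dotDZ lerD2l ler_pM2l // c_maxK.
by have [->|/sep_k] := eqVneq k j.
Qed.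

(** The vector [(u, h u)], with [h] the support function of [K], when [c]
    maximises [dot u] on [K]. *)
Definition contact_vec {R : realType} {n} (u c : 'rV[R]_n) : 'rV[R]_(n + 1) :=
  row_mx u (dot u c)%:M.

Definition homothet_form {R : realType} {n} (a : 'rV[R]_n) (l : R)
  : 'cV[R]_(n + 1) := col_mx a^T l%:M.

Lemma contact_formE {R : realType} {n} (u c a : 'rV[R]_n) (l : R) :
  (contact_vec u c *m homothet_form a l) 0 0 = dot u (a + l *: c).
Proof.
by rewrite mul_row_col -scalar_mxM dotDZ mxE [X in _ + X]mxE mulr1n mulrC.
Qed.

Lemma homothets_params {R : realType} {n} {I : Type} {K : set 'rV[R]_n}
    {B : I -> set 'rV[R]_n} : (forall i, homothets K (B i)) ->
  exists a l, (forall i, 0 < l i) /\ B = fun i => homothet K (a i) (l i).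
Proof.
move=> hB; have /choice [f hf] : forall i, exists p : 'rV[R]_n * R,
    0 < p.2 /\ B i = homothet K p.1 p.2.
  by move=> i; have [a [l l_gt0 BE]] := hB i; exists (a, l).
exists (fst \o f), (snd \o f); split=> [i|]; first by have [] := hf i.
by apply/funext => i; have [] := hf i.
Qed.

Theorem theorem2 (R : realType) (n : nat) (hn : (3 <= n)%N)
    (K : set 'rV[R]_2) (hK : convex_body K)
    (A : bool -> set 'rV[R]_2) (G : 'I_n -> set 'rV[R]_2)
    (hA : forall i : bool, homothets K (A i))
    (hG : forall j : 'I_n, homothets K (G j))
    (hAG : forall i : bool, A i `<=` conv_hull (\bigcup_j G j)) :
  exists (i : bool) (j : 'I_n),
    A i `<=` conv_hull (A (~~ i) `|` \bigcup_(k in [set k | k != j]) G k).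
Proof.
have [cK kK _] := hK.
have [a [al [al_gt0 AE]]] := homothets_params hA.
have [g [ga [ga_gt0 GE]]] := homothets_params hG.
subst A G; apply: contrapT => none.
pose w := widen_ord hn.
have w_inj : injective w by move=> j k /(congr1 val) jk; apply: val_inj.
have contact i (j : 'I_3) := separating_contact cK kK (al_gt0 i) ga_gt0 (hAG i)
  (fun sub => none (ex_intro _ i (ex_intro _ (w j) sub))).
have /choice [p hp] := contact false; have /choice [x hx] := contact true.
pose vec uc := contact_vec uc.1 uc.2 : 'rV[R]_(2 + 1).
pose form := @homothet_form R 2.
have vec_form uc a' l : (vec uc *m form a' l) 0 0 = dot uc.1 (a' + l *: uc.2).
  exact: contact_formE.
have vec_formB uc a1 l1 a2 l2 : (vec uc *m form (a1 - a2) (l1 - l2)) 0 0 =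
    dot uc.1 (a1 + l1 *: uc.2) - dot uc.1 (a2 + l2 *: uc.2).
  by rewrite vec_form !dotDZ (dotC uc.1) dotBl !(dotC _ uc.1); ring.
have vec_formN uc c : (vec uc *m form (- c) 1) 0 0 = dot uc.1 uc.2 - dot uc.1 c.
  by rewrite vec_form scale1r addrC dotC dotBl !(dotC _ uc.1).
apply: (@no_six_vectors _ (fun j => vec (p j)) (fun j => vec (x j))
  (fun j => form (a false - g (w j)) (al false - ga (w j)))
  (fun j => form (- (p j).2) 1)
  (form (a false - a true) (al false - al true)))
  => [j|j|j k kj|j|j|j k|j|j k|j].
all: rewrite ?vec_formB ?vec_formN ?subrr.
all: rewrite ?subr_gt0 ?subr_lt0 ?subr_le0 ?subr_ge0 //.
- by have := hp j; case: (p j) => u c [].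
- by have := hx j; case: (x j) => u c [].
- have := hp k; case: (p k) => u c [_ _ + _]; apply.
  by rewrite inj_eq // eq_sym.
- by have := hp j; case: (p j) => u c [].
- by have := hx j; case: (x j) => u c [_ ? _ ?]; apply: lt_le_trans; eauto.
- have := hp k; have := hp j; case: (p k) => u c; case: (p j) => u' c'.
  by move=> [[Kc' _] _ _ _] [[_ max_c] _ _ _]; apply: max_c.
- have := hx k; have := hp j; case: (x k) => u c; case: (p j) => u' c'.
  by move=> [[Kc' _] _ _ _] [[_ max_c] _ _ _]; apply: max_c.
(* the supporting forms [(- c, 1)] are nonzero by their last coefficient *)
- apply/eqP => /(congr1 (fun M : 'cV[R]_(2 + 1) => M (rshift 2 ord0) 0)).
  by rewrite col_mxEd !mxE => /eqP; rewrite oner_eq0.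
Qed.
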